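(* Let $k\ge1$ and let $\bar P_{(k,k)}$ be the poset on $\{a_1,\dots,a_k,b_1,\dots,b_k\}$ generated by the cover relations $a_{j+1}\prec a_j$ for $1\le j\le k-1$ and $b_j\prec a_j$ for $1\le j\le k$ (the ladder poset $P_{(k,k)}$ with the relations among the $b_j$ removed). Then for all $n\ge0$, \[ \mathrm{ehr}(\mathcal{O}(\bar P_{(k,k)}),n)=S(n+k+1,n+1), \] where $S(r,s)$ is the Stirling number of the second kind.
   Context: For a finite poset $P$, the order polytope $\mathcal{O}(P)\subset\mathbb{R}^P$ is defined by $0\le x_s\le1$ and $x_s\le x_{s'}$ whenever $s\prec s'$; $\mathrm{ehr}(\mathcal{O}(P),n)=|n\mathcal{O}(P)\cap\mathbb{Z}^P|$ for $n\ge1$ and $=1$ for $n=0$ (it counts order-preserving maps $P\to\{0,\dots,n\}$). $S(r,s)$ is the number of partitions of an $r$-set into $s$ nonempty blocks. *)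

(* Defs.v *)
From HB Require Import structures.
From mathcomp Require Import all_boot all_order all_algebra finmap.
From mathcomp Require Import boolp classical_sets functions cardinality reals.

Set Implicit Arguments.
Unset Strict Implicit.
Unset Printing Implicit Defensive.

Import Order.TTheory GRing.Theory Num.Theory.

Definition stirling2 (r s : nat) : nat :=
  #|[set B : {set {set 'I_r}} | finset.partition B [set: 'I_r] & #|B| == s]|.

Local Open Scope classical_set_scope.
Local Open Scope ring_scope.

Section OrderPolytope.
Context {d : Order.disp_t} (R : realType) (P : finPOrderType d).

Definition order_polytope : set {ffun P -> R} :=
  [set x : {ffun P -> R} | (forall s, 0 <= x s <= 1) /\
                          (forall s t, (s < t)%O -> x s <= x t)].

Definition dilate (n : nat) (A : set {ffun P -> R}) : set {ffun P -> R} :=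
  [set [ffun s => n%:R * x s] | x in A].

Definition lattice_points (A : set {ffun P -> R}) : set {ffun P -> R} :=
  A `&` [set x : {ffun P -> R} | forall s, x s \is a Num.int].

(* [fset_set] returns the empty set on infinite sets; see
   [finite_lattice_points] below. *)
Definition ehr (n : nat) : nat :=
  if n is 0%N then 1%N
  else #|` fset_set (lattice_points (dilate n order_polytope)) |.

Lemma finite_lattice_points (n : nat) :
  finite_set (lattice_points (dilate n order_polytope)).
Proof.
pose F (g : {ffun P -> 'I_n.+1}) : {ffun P -> R} := [ffun s => (g s)%:R].
apply: (@sub_finite_set _ _ (F @` [set: {ffun P -> 'I_n.+1}])); last first.
  exact/finite_image/finite_finset.
move=> _ [[x [x01 _] <-] xint].
have val s : exists i : 'I_n.+1, n%:R * x s == i%:R :> R.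
  have /intrP[z zE] := xint s; rewrite ffunE in zE.
  have /andP[x0 x1] := x01 s.
  have: 0 <= n%:R * x s <= n%:R.
    by rewrite mulr_ge0 // ler_piMr.
  rewrite zE ler0z -[n%:R]/(n%:Z%:~R) ler_int => /andP[].
  case: z zE => // m _ _; rewrite lez_nat -ltnS => mn.
  by exists (Ordinal mn).
exists [ffun s => xchoose (val s)] => //.
by apply/ffunP => s; rewrite !ffunE; apply/esym/eqP/(xchooseP (val s)).
Qed.

End OrderPolytope.

Section LadderBar.
Variable k : nat.

(* [inl j] is a_(j+1) and [inr j] is b_(j+1), for 0 <= j < k. *)
Definition ladder_bar : Type := ('I_k + 'I_k)%type.

HB.instance Definition _ := Finite.copy ladder_bar ('I_k + 'I_k)%type.

Definition ladder_bar_cover (x y : ladder_bar) : bool :=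
  match x, y with
  | inl i, inl j => i == j.+1 :> nat
  | inr i, inl j => i == j
  | _, inr _ => false
  end.

Definition ladder_bar_le : rel ladder_bar := connect ladder_bar_cover.

Let rank (x : ladder_bar) : nat := if x is inl i then k - i else 0.

Let rank_cover x y : ladder_bar_cover x y -> (rank x < rank y)%N.
Proof.
case: x y => [i|i] [j|j] //= => [/eqP ij|_]; last by rewrite subn_gt0.
by rewrite ij ltn_sub2l // -ij ltnW.
Qed.

Let rank_connect x y : ladder_bar_le x y -> x = y \/ (rank x < rank y)%N.
Proof.
case/connectP => p; elim: p x => [|z p IH] x /=; first by move=> _ ->; left.
case/andP=> /rank_cover xz /IH{}IH /IH[<-|zy]; right => //.
exact: ltn_trans zy.
Qed.

Fact ladder_bar_le_refl : reflexive ladder_bar_le.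
Proof. exact: connect0. Qed.

Fact ladder_bar_le_anti : antisymmetric ladder_bar_le.
Proof.
move=> x y /andP[/rank_connect[//|xy] /rank_connect[//|yx]].
by have := ltn_trans xy yx; rewrite ltnn.
Qed.

Fact ladder_bar_le_trans : transitive ladder_bar_le.
Proof. exact: connect_trans. Qed.

Fact ladder_bar_display : Order.disp_t. Proof. exact: Order.Disp tt tt. Qed.

HB.instance Definition _ := Order.Le_isPOrder.Build ladder_bar_display
  ladder_bar ladder_bar_le_refl ladder_bar_le_anti ladder_bar_le_trans.

End LadderBar.

(* Main.v *)
(* An order-preserving map on the ladder is a sequence a_1 >= ... >= a_k in
   {0, ..., n} together with, for each j, any of the a_j + 1 values b_j <= a_j.
   Conditioning on a_1 = i, the number of such maps with a_1 < m satisfies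
   F (k+1) m = \sum_(i < m) (i + 1) F k (i + 1), and F k m = S(m + k, m) solves
   this: iterating the recurrence S(r+1, s+1) = S(r, s) + (s+1) S(r, s+1) along
   the diagonal of fixed r - s gives the same sum. *)
From mathcomp Require Import boolp classical_sets cardinality.
Require Import Defs.
From mathcomp Require Import finmap all_boot all_order all_algebra reals.

Set Implicit Arguments.
Unset Strict Implicit.
Unset Printing Implicit Defensive.

Import Order.TTheory GRing.Theory Num.Theory.

(** * Inserting a new element into a block of a set partition, and removing it *)

Section PartitionExtension.
Variables (T : finType) (x : T).
Implicit Types (B C D : {set T}) (P : {set {set T}}).

Lemma disjoint_block P D B :
  finset.partition P D -> B != set0 -> [disjoint B & D] -> B \notin P.
Proof.
move=> partP /set0Pn[y By] dBD; apply/negP.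
move=> /(partitionS partP) /subsetP /(_ y By) Dy.
by rewrite (disjointFr dBD By) in Dy.
Qed.

(** The pair is a partition with a marked block, the one that receives [x]. Keeping the mark in the
    value of [restrict_block] makes the two maps mutually inverse. *)
Definition extend_block (PC : {set {set T}} * {set T}) :=
  (x |: PC.2) |: (PC.1 :\ PC.2).

Definition restrict_block P : {set {set T}} * {set T} :=
  let A := pblock P x in ((A :\ x) |: (P :\ A), A :\ x).

Lemma disjoint_extend D C : x \notin D -> [disjoint x |: C & D :\: C].
Proof.
move=> xD; apply/pred0P => y /=; rewrite !inE.
by case: eqP => [->|_] /=; [rewrite (negPf xD) andbF | case: (y \in C)].
Qed.

Lemma extend_block_partition D P C : x \notin D ->
  finset.partition P D -> C \in P ->
  [/\ finset.partition (extend_block (P, C)) (x |: D),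
      #|extend_block (P, C)| = #|P|, [set x] \notin extend_block (P, C)
    & restrict_block (extend_block (P, C)) = (P, C)].
Proof.
move=> xD partP PC; have sCD := partitionS partP PC.
have partPC := partitionD1 partP PC.
have dC := disjoint_extend C xD.
have xC0 : x |: C != set0 by apply/set0Pn; exists x; rewrite setU11.
have xCP := disjoint_block partPC xC0 dC.
have xC : x \notin C by apply: contra xD; apply: (subsetP sCD).
have part : finset.partition (extend_block (P, C)) (x |: D).
  have := partitionU1 partPC xC0 dC.
  rewrite -setUA (_ : C :|: D :\: C = D) //.
  by rewrite -[RHS](setID D C) (setIidPr sCD).
split => //.
- by rewrite cardsU1 xCP [in RHS](cardsD1 C) PC.
(* The enlarged block contains an element of the nonempty block [C] besides [x], and every other
   block lies in [D], which misses [x]. *)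
- rewrite !inE negb_or; apply/andP; split.
    have /set0Pn[y Cy] := partition_neq0 partP PC.
    apply/eqP => /finset.setP /(_ y); rewrite !inE Cy orbT => /eqP yx.
    by rewrite -yx Cy in xC.
  rewrite negb_and; apply/orP; right; apply/negP => /(partitionS partP).
  by rewrite sub1set (negPf xD).
rewrite /restrict_block (@def_pblock _ _ (x |: C)) ?setU11 //; last first.
  exact: partition_trivIset part.
have -> : (x |: C) :\ x = C by rewrite setU1K.
by rewrite /extend_block setU1K ?setD1K.
Qed.

(** Since [[set x]] is not a block, the block of [x] stays nonempty when [x] is removed, so the
    result is again a partition. *)
Lemma restrict_block_partition D P : x \notin D ->
  finset.partition P (x |: D) -> [set x] \notin P ->
  [/\ finset.partition (restrict_block P).1 D,
      (restrict_block P).2 \in (restrict_block P).1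
    & extend_block (restrict_block P) = P].
Proof.
move=> xD partP Px; rewrite /restrict_block; set A := pblock P x.
have xcov : x \in cover P by rewrite (cover_partition partP) setU11.
have PA : A \in P by exact: pblock_mem.
have xA : x \in A by rewrite mem_pblock.
have sA : A \subset x |: D := partitionS partP PA.
have A0 : A :\ x != set0.
  apply: contraNneq Px => A0.
  by rewrite -(_ : A = [set x]) // -(setD1K xA) A0 setU0.
have dA : [disjoint A :\ x & (x |: D) :\: A].
  by apply/pred0P => y /=; rewrite !inE; case: (y \in A); rewrite ?andbF.
have partPA := partitionD1 partP PA.
have AP := disjoint_block partPA A0 dA.
split => /=; last by rewrite /extend_block /= setU1K // !setD1K.
  have := partitionU1 partPA A0 dA; congr finset.partition.
  apply/finset.setP => y; rewrite !inE; case: (eqVneq y x) => [->|yx] /=.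
    by rewrite xA (negPf xD).
  case yA: (y \in A) => //=; have := subsetP sA y yA.
  by rewrite !inE (negPf yx).
exact: setU11.
Qed.

End PartitionExtension.

(** * The recurrence for Stirling numbers of the second kind *)

Definition partitions_into (T : finType) (D : {set T}) (s : nat) :=
  [set P : {set {set T}} | finset.partition P D & #|P| == s].

(** Adding and deleting the block [[set x]] are inverse to each other, and [disjoint_block] shows
    that the added block is new. *)
Lemma card_partitions_split1 (T : finType) (x : T) (D : {set T}) (s : nat) :
  x \notin D ->
  #|[set P in partitions_into (x |: D) s.+1 | [set x] \in P]| =
  #|partitions_into D s|.
Proof.
move=> xD.
have x0 : [set x] != finset.set0 :> {set T} by rewrite -card_gt0 cards1.
have dx : [disjoint [set x] & D].
  by rewrite disjoints1.
rewrite -(@card_in_imset _ _ (fun P : {set {set T}} => [set x] |: P)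
  (mem (partitions_into D s))); last first.
  move=> P Q; rewrite !inE => /andP[partP _] /andP[partQ _] PQ.
  rewrite -(setU1K (disjoint_block partP x0 dx)) PQ.
  by rewrite setU1K // (disjoint_block partQ x0 dx).
apply: eq_card => P; apply/idP/imsetP => [|[Q Qp ->]].
  rewrite !inE => /andP[/andP[partP Ps] xP].
  exists (P :\ [set x]); last by rewrite setD1K.
  rewrite !inE; have := partitionD1 partP xP; rewrite setU1K // => -> /=.
  by move: Ps; rewrite (cardsD1 [set x]) xP.
move: Qp; rewrite !inE => /andP[partQ /eqP <-].
by rewrite partitionU1 //= cardsU1 (disjoint_block partQ x0 dx) !eqxx.
Qed.

(** By [extend_block], these partitions correspond to partitions of [D] with a marked block; the
    factor [s] counts the choices of the mark. *)
Lemma card_partitions_split2 (T : finType) (x : T) (D : {set T}) (s : nat) :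
  x \notin D ->
  #|[set P in partitions_into (x |: D) s | [set x] \notin P]| =
  s * #|partitions_into D s|.
Proof.
move=> xD.
pose E := [set PC : {set {set T}} * {set T} |
  (PC.1 \in partitions_into D s) && (PC.2 \in PC.1)].
transitivity #|E|.
  rewrite -(@card_in_imset _ _ (extend_block x) (mem E)); last first.
    apply: (can_in_inj (g := restrict_block x)) => -[P C].
    rewrite !inE /= => /andP[/andP[partP _] PC].
    by case: (extend_block_partition xD partP PC).
  apply: eq_card => P; apply/idP/imsetP => [|[[Q C] QC ->]].
    rewrite !inE => /andP[/andP[partP Ps] xP].
    case: (restrict_block_partition xD partP xP).
    case: (restrict_block x P) => Q C /= partQ QC QP; exists (Q, C) => //.
    rewrite !inE /= partQ QC andbT andTb -(eqP Ps) -QP.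
    by case: (extend_block_partition xD partQ QC) => _ -> _ _; rewrite eqxx.
  rewrite !inE /= in QC; case/andP: QC => /andP[partQ Qs] QC.
  case: (extend_block_partition xD partQ QC) => partE cardE xE _.
  by apply/setIdP; split=> //; rewrite inE partE cardE.
rewrite -sum1_card (eq_bigl _ _ (in_set _)) -(pair_big_dep
  (fun P => P \in partitions_into D s) (fun (P : {set {set T}}) C => C \in P)
  (fun _ _ => 1)) /=.
rewrite (eq_bigr (fun=> s)) => [|P]; first by rewrite sum_nat_const mulnC.
by rewrite inE sum1_card => /andP[_ /eqP].
Qed.

Fixpoint stirling_rec (r s : nat) : nat :=
  match r, s with
  | 0, 0 => 1
  | r'.+1, s'.+1 => stirling_rec r' s' + s * stirling_rec r' s
  | _, _ => 0
  end.

Lemma stirling_rec_small r s : r < s -> stirling_rec r s = 0.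
Proof.
by elim: r s => [|r IH] [|s] //= rs; rewrite !IH ?muln0 // ltnW.
Qed.

Lemma stirling_rec_diag r : stirling_rec r r = 1.
Proof. by elim: r => //= r ->; rewrite stirling_rec_small ?muln0. Qed.

Lemma card_partitions_into (T : finType) (D : {set T}) (s : nat) :
  #|partitions_into D s| = stirling_rec #|D| s.
Proof.
move: {2}#|D| (erefl #|D|) => r; elim: r D s => [|r IH] D s Dr.
  have -> : D = finset.set0 by apply/eqP; rewrite -cards_eq0 Dr.
  rewrite cards0; case: s => [|s]; rewrite /partitions_into.
    rewrite (_ : [set _ | _] = [set finset.set0]) ?cards1 //.
    apply/finset.setP => P; rewrite !inE partition_set0.
    by case: eqP => // ->; rewrite cards0.
  apply/eqP; rewrite cards_eq0; apply/eqP/finset.setP => P.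
  by rewrite !inE partition_set0; case: eqP => // ->; rewrite cards0.
have /set0Pn[x xD] : D != finset.set0 by rewrite -card_gt0 Dr.
have Dxr : #|D :\ x| = r by move: Dr; rewrite (cardsD1 x) xD => -[].
rewrite -(setD1K xD); have : x \notin D :\ x by rewrite setD11.
move: (D :\ x) Dxr => {Dr xD}D Dr xD; rewrite cardsU1 xD add1n /=.
case: s => [|s].
  apply/eqP; rewrite cards_eq0; apply/eqP/finset.setP => P; rewrite !inE.
  apply/negP => /andP[/cover_partition + /eqP/cards0_eq P0].
  by rewrite P0 /cover big_set0 => /finset.setP /(_ x); rewrite !inE eqxx.
(* The two terms of the recurrence separate the partitions in which [x] forms a block alone from the
   others. *)
rewrite -(cardsID [set P : {set {set T}} | [set x] \in P]) -!IH //.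
rewrite -(card_partitions_split1 s xD) -(card_partitions_split2 s.+1 xD).
by congr (_ + _); apply: eq_card => P; rewrite !inE // andbC.
Qed.

Lemma stirling2E r s : stirling2 r s = stirling_rec r s.
Proof. by rewrite -[r in RHS]card_ord -cardsT -card_partitions_into. Qed.

(** * Counting sequences of rungs as paths of a relation *)

Lemma card_paths_cons (T : finType) (r : rel T) (x : T) (k : nat) :
  #|[set t : k.+1.-tuple T | path r x t]| =
  \sum_(y | r x y) #|[set t : k.-tuple T | path r y t]|.
Proof.
under eq_bigr do rewrite -sum1_card.
rewrite pair_big_dep -sum1_card.
pose f (p : T * k.-tuple T) : k.+1.-tuple T := [tuple of p.1 :: p.2].
rewrite (reindex f) /=; last first.
  exists (fun t => (thead t, [tuple of behead t])) => [[y t]|t] _ /=.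
    by congr pair; apply: val_inj.
  by rewrite /f /= -tuple_eta.
by apply: eq_bigl => -[y t]; rewrite !inE.
Qed.

(** The sum telescopes: by the recurrence, the term of index [i] is the difference of the right-hand
    sides at [i.+1] and [i], and the right-hand side vanishes at 0. *)
Lemma sum_stirling_rec k m :
  \sum_(i < m) i.+1 * stirling_rec (i + k).+1 i.+1 = stirling_rec (m + k).+1 m.
Proof. by elim: m => [|m IH]; rewrite ?big_ord0 // big_ord_recr IH. Qed.

(** A pair stands for a rung (a_j, b_j), and a step goes from rung j to rung j+1. The bound of b by
    a is tested on the target, so a path from [p] constrains exactly the rungs listed after [p]. *)
Definition rung_rel (N : nat) : rel ('I_N * 'I_N) :=
  fun p q => (q.1 <= p.1) && (q.2 <= q.1).

Lemma card_rung_paths N k (p : 'I_N * 'I_N) :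
  #|[set t : k.-tuple ('I_N * 'I_N) | path (@rung_rel N) p t]| =
  stirling_rec (p.1 + k).+1 p.1.+1.
Proof.
elim: k p => [|k IH] p.
  rewrite addn0 stirling_rec_diag; apply/eqP/cards1P; exists [tuple].
  by apply/finset.setP => t; rewrite tuple0 !inE eqxx.
rewrite card_paths_cons; under eq_bigr do rewrite IH.
(* The count given by induction depends only on the first entry i of the next rung; its second entry
   takes i + 1 values, whence the factor [i.+1]. *)
rewrite -(pair_big_dep (fun i : 'I_N => i <= p.1) (fun i j : 'I_N => j <= i)
  (fun i _ => stirling_rec (i + k).+1 i.+1)).
rewrite addnS -addSn -sum_stirling_rec.
rewrite (big_ord_widen _ (fun i => i.+1 * stirling_rec (i + k).+1 i.+1)
  (ltn_ord p.1)).
apply: eq_bigr => i _; rewrite sum_nat_const; congr (_ * _).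
by rewrite -sum1_card -(big_ord_widen _ (fun=> 1) (ltn_ord i)) sum1_card card_ord.
Qed.

(** * Lattice points of the dilated order polytope as order-preserving maps *)

Definition monotone_maps (d : Order.disp_t) (P : finPOrderType d) (n : nat) :=
  [set g : {ffun P -> 'I_n.+1} |
    [forall s, forall t, (s <= t)%O ==> (g s <= g t)]].

Lemma monotone_mapsP (d : Order.disp_t) (P : finPOrderType d) (n : nat)
    (g : {ffun P -> 'I_n.+1}) :
  reflect (forall s t, (s <= t)%O -> g s <= g t) (g \in monotone_maps P n).
Proof.
rewrite inE; apply: (iffP forallP) => [H s t st | H s].
  by have /forallP/(_ t)/implyP := H s; apply.
by apply/forallP => t; apply/implyP/H.
Qed.

Lemma lattice_points_dilate (R : realType) (d : Order.disp_t)
    (P : finPOrderType d) (n : nat) (y : {ffun P -> R}) : (0 < n)%N ->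
  lattice_points (dilate n (@order_polytope d R P)) y <->
  exists2 g : {ffun P -> 'I_n.+1}, g \in monotone_maps P n &
    y = [ffun s => (g s)%:R%R].
Proof.
move=> n0; have n0R : (0 < n%:R :> R)%R by rewrite ltr0n.
split=> [[[x [x01 xle] <-] xint] | [g /monotone_mapsP gle ->]].
  (* An integer between 0 and n is the value of an element of ['I_n.+1]. *)
  have val s : exists i : 'I_n.+1, (n%:R * x s == i%:R :> R)%R.
    have /intrP[z zE] := xint s; rewrite ffunE in zE.
    have /andP[x0 x1] := x01 s.
    have: (0 <= n%:R * x s <= n%:R)%R by rewrite mulr_ge0 // ler_piMr.
    rewrite zE ler0z -[n%:R%R]/(n%:Z%:~R)%R ler_int => /andP[].
    case: z zE => // m _ _; rewrite lez_nat -ltnS => mn.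
    by exists (Ordinal mn).
  have gE s := eqP (xchooseP (val s)).
  exists [ffun s => xchoose (val s)]; last by apply/ffunP => s; rewrite !ffunE.
  apply/monotone_mapsP => s t; rewrite !ffunE -(ler_nat R) -!gE ler_pM2l //.
  by rewrite le_eqVlt => /predU1P[->//|/xle].
split=> [|s]; last by rewrite ffunE; apply: natr_int.
(* Conversely, g / n is the point of the undilated polytope whose dilate is g. *)
exists [ffun s => (g s)%:R / n%:R]%R; last first.
  by apply/ffunP => s; rewrite !ffunE mulrC divfK // gt_eqF.
split=> [s|s t st]; rewrite !ffunE.
  by rewrite divr_ge0 //= ler_pdivrMr // mul1r ler_nat -ltnS ltn_ord.
by rewrite ler_pM2r ?invr_gt0 // ler_nat gle // ltW.
Qed.

Lemma ehr_monotone_maps (R : realType) (d : Order.disp_t)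
    (P : finPOrderType d) (n : nat) :
  ehr R P n = #|monotone_maps P n|.
Proof.
case: n => [|n]; rewrite /ehr.
  (* The conventional value 1 at n = 0 agrees with the count: the only map to ['I_1] is
     order-preserving. *)
  rewrite (_ : monotone_maps P 0 = setT) ?cardsT ?card_ffun ?card_ord ?exp1n //.
  apply/finset.setP => g; rewrite [RHS]inE.
  by apply/monotone_mapsP => s t; rewrite !ord1.
pose F (g : {ffun P -> 'I_n.+2}) : {ffun P -> R} := [ffun s => (g s)%:R%R].
have F_inj : injective F.
  move=> g h /ffunP gh; apply/ffunP => s; apply/val_inj/eqP.
  by rewrite -(eqr_nat R); have := gh s; rewrite !ffunE => ->.
have -> : fset_set (lattice_points (dilate n.+1 (@order_polytope d R P))) =
    [fset F g | g in monotone_maps P n.+1]%fset.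
  apply/fsetP => y; rewrite in_fset_set; last exact: finite_lattice_points.
  apply/idP/imfsetP => [/set_mem /lattice_points_dilate[//|g gM ->]|[g gM ->]].
    by exists g.
  by apply/mem_set/lattice_points_dilate => //; exists g.
rewrite card_imfset // cardE; apply/perm_size/uniq_perm.
- exact: enum_finmem_uniq.
- exact: enum_uniq.
- by move=> g; rewrite [LHS]enum_finmemE mem_enum.
Qed.

(** * Order-preserving maps on the ladder as paths of rungs *)

Section LadderMaps.
Variables k n : nat.

Definition rungs (g : {ffun ladder_bar k -> 'I_n.+1}) :
    k.-tuple ('I_n.+1 * 'I_n.+1) :=
  [tuple (g (inl i), g (inr i)) | i < k].

Lemma rungs_bij : bijective rungs.
Proof.
exists (fun t => [ffun x : ladder_bar k => match x with
  | inl i => (tnth t i).1 | inr i => (tnth t i).2 end]) => [g|t].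
  by apply/ffunP => -[i|i]; rewrite !ffunE tnth_mktuple.
by apply: eq_from_tnth => i; rewrite tnth_mktuple !ffunE; case: (tnth t i).
Qed.

(** The order is the reflexive transitive closure of the covers, so the inequalities compose along a
    chain of covers. *)
Lemma ladder_bar_monotone (g : {ffun ladder_bar k -> 'I_n.+1}) :
  (forall x y, ladder_bar_cover x y -> g x <= g y) ->
  g \in monotone_maps (ladder_bar k) n.
Proof.
move=> gcover; apply/monotone_mapsP => s t /connectP[p].
elim: p s => [|x p IH] s /=; first by move=> _ ->.
by case/andP=> /gcover sx /IH{}IH /IH; apply: leq_trans.
Qed.

(** The steps of the path match the cover relations one by one. The starting pair is a sentinel: its
    first entry n bounds a_1, which holds for every map. *)
Lemma monotone_rungs (g : {ffun ladder_bar k -> 'I_n.+1}) :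
  (g \in monotone_maps (ladder_bar k) n) =
  path (@rung_rel n.+1) (ord_max, ord_max) (rungs g).
Proof.
have nthE (i : 'I_k) :
      nth (ord_max, ord_max) (rungs g) i = (g (inl i), g (inr i)).
  by rewrite -tnth_nth tnth_mktuple.
apply/idP/(pathP (ord_max, ord_max)) => [/monotone_mapsP gle i | gpath].
  rewrite size_tuple => ik; rewrite /rung_rel (nthE (Ordinal ik)) /=.
  apply/andP; split; last by apply/gle/connect1/eqxx.
  (* The first rung is compared with the sentinel, each later one with its predecessor through the
     cover of a_j by a_(j+1) reversed, that is, a_(j+1) below a_j. *)
  case: i ik => [|i] ik /=; first by rewrite -ltnS.
  by rewrite (nthE (Ordinal (ltnW ik))); apply/gle/connect1/eqxx.
apply: ladder_bar_monotone => -[i|i] [j|j] //= /eqP ij.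
  have := gpath i; rewrite size_tuple => /(_ (ltn_ord i)) /andP[].
  by rewrite nthE ij /= nthE.
have := gpath i; rewrite size_tuple => /(_ (ltn_ord i)) /andP[_].
by rewrite nthE ij.
Qed.

End LadderMaps.

Theorem theorem6p1 (R : realType) (k : nat) (hk : (1 <= k)%N) (n : nat) :
  ehr R (ladder_bar k) n = stirling2 (n + k + 1)%N (n + 1)%N.
Proof.
rewrite ehr_monotone_maps stirling2E !addn1.
(* The first entry of the starting pair is n, which turns the path count into S(n + k + 1, n +
   1). *)
rewrite -(card_rung_paths k (ord_max, ord_max)).
rewrite -(on_card_preimset (onW_bij _ (rungs_bij k n))).
by apply: eq_card => g; rewrite !inE -monotone_rungs inE.
Qed.
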